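(* For every $n\ge1$, if $\Omega_n$ is an invertible complex $2n\times 2n$ matrix which is a Type-II matrix, then $\Omega_n^{-1}$ is a Type-I matrix.
   Context: Let $M$ be a $2n\times 2n$ complex matrix, written as an $n\times n$ array of $2\times2$ complex blocks $M=(B_{jk})_{j,k=1}^n$. Let $I_2$ be the $2\times2$ identity matrix and $i=\sqrt{-1}$. $M$ is called a Type-I matrix if for every $j$ there is $t_j\in\mathbb C$ with $B_{jj}=t_jI_2$, and for every $1\le j<k\le n$ there are complex numbers $a_{jk},b_{jk},c_{jk},d_{jk}$ such that $$B_{jk}=\begin{pmatrix}a_{jk}&b_{jk}\\c_{jk}&d_{jk}\end{pmatrix},\qquad B_{kj}=\begin{pmatrix}d_{jk}&-b_{jk}\\-c_{jk}&a_{jk}\end{pmatrix}.$$ $M$ is called a Type-II matrix if for every $j$ there is $t_j\in\mathbb C$ with $B_{jj}=t_jI_2$, and for every $1\le j<k\le n$ there are complex numbers $a_{jk},b_{jk},c_{jk},d_{jk}$ such that $$B_{jk}=\begin{pmatrix}a_{jk}+c_{jk}i&b_{jk}+d_{jk}i\\-\bar b_{jk}-\bar d_{jk}i&\bar a_{jk}+\bar c_{jk}i\end{pmatrix},\qquad B_{kj}=\begin{pmatrix}\bar a_{jk}+\bar c_{jk}i&-b_{jk}-d_{jk}i\\\bar b_{jk}+\bar d_{jk}i&a_{jk}+c_{jk}i\end{pmatrix}.$$ *)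

(* Defs.v *)
From HB Require Import structures.
From mathcomp Require Import all_boot all_order all_algebra.
From mathcomp Require Import complex reals.

Set Implicit Arguments.
Unset Strict Implicit.
Unset Printing Implicit Defensive.

Import GRing.Theory.
Local Open Scope ring_scope.

Lemma block_idx_subproof (n : nat) (j : 'I_n) (r : 'I_2) :
  (2 * j + r < 2 * n)%N.
Proof.
have: (2 * j.+1 <= 2 * n)%N by rewrite leq_mul2l ltn_ord.
by apply: leq_trans; rewrite mulnS addnC ltn_add2r ltn_ord.
Qed.

Definition block_idx (n : nat) (j : 'I_n) (r : 'I_2) : 'I_(2 * n) :=
  Ordinal (block_idx_subproof j r).

(* The 2 x 2 block B_jk, with j and k counted from 0. *)
Definition block (T : Type) (n : nat) (M : 'M[T]_(2 * n)) (j k : 'I_n) :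
    'M[T]_2 :=
  mxsub (block_idx j) (block_idx k) M.

Definition mx22 (T : pzRingType) (a b c d : T) : 'M[T]_2 :=
  \matrix_(r, s) nth 0 (nth [::] [:: [:: a; b]; [:: c; d]] r) s.

Definition typeI (R : realType) (n : nat) (M : 'M[R[i]]_(2 * n)) : Prop :=
  (forall j : 'I_n, exists t : R[i], block M j j = t%:M) /\
  (forall j k : 'I_n, (j < k)%N -> exists a b c d : R[i],
     block M j k = mx22 a b
                        c d /\
     block M k j = mx22 d (- b)
                        (- c) a).

Definition typeII (R : realType) (n : nat) (M : 'M[R[i]]_(2 * n)) : Prop :=
  (forall j : 'I_n, exists t : R[i], block M j j = t%:M) /\
  (forall j k : 'I_n, (j < k)%N -> exists a b c d : R[i],
     block M j k = mx22 (a + c * 'i%C) (b + d * 'i%C)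
                        (- b^*%C - d^*%C * 'i%C) (a^*%C + c^*%C * 'i%C) /\
     block M k j = mx22 (a^*%C + c^*%C * 'i%C) (- b - d * 'i%C)
                        (b^*%C + d^*%C * 'i%C) (a + c * 'i%C)).

(* Main.v *)
Require Import Defs.
From mathcomp Require Import all_boot all_order all_algebra.
From mathcomp Require Import complex reals.
From mathcomp Require Import zify ring.

Import GRing.Theory Num.Theory.
Local Open Scope ring_scope.

(** Let [K] be the block diagonal matrix with diagonal blocks [[0, 1], [-1, 0]].
    Conjugating a transposed 2 x 2 block by [K] yields its adjugate, and a
    2 x 2 matrix equals its adjugate iff it is scalar. Hence [M] is Type-I iff
    [M^T K = K M], a condition stable under inversion; and every Type-II matrix
    is visibly Type-I. *)

Lemma block_idxP (n : nat) (x : 'I_(2 * n)) :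
  exists (j : 'I_n) (r : 'I_2), x = block_idx j r.
Proof.
have hj : (x %/ 2 < n)%N by have := ltn_ord x; lia.
have hr : (x %% 2 < 2)%N by lia.
exists (Ordinal hj), (Ordinal hr); apply/val_inj => /=; lia.
Qed.

(** Exchanging the two indices of a block stays in range: an even index below the even number
    [2 * n] has its successor below it too. *)
Lemma block_swap_subproof (n : nat) (x : 'I_(2 * n)) :
  ((if odd x then x.-1 else x.+1) < 2 * n)%N.
Proof. by have := ltn_ord x; case: ifP; lia. Qed.

Definition block_swap (n : nat) (x : 'I_(2 * n)) : 'I_(2 * n) :=
  Ordinal (block_swap_subproof n x).

Lemma block_swap_idx (n : nat) (j : 'I_n) (r : 'I_2) :
  block_swap n (block_idx j r) = block_idx j (rev_ord r).
Proof.
by apply/val_inj => /=; case: r => -[|[|//]] ? /=; case: ifP => /=; lia.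
Qed.

Lemma block_swapK (n : nat) : involutive (block_swap n).
Proof.
move=> x; have [j [r ->]] := block_idxP n x.
by rewrite !block_swap_idx rev_ordK.
Qed.

Lemma odd_block_idx (n : nat) (j : 'I_n) (r : 'I_2) :
  odd (block_idx j r) = odd r.
Proof. by rewrite /= oddD oddM. Qed.

Lemma odd_block_swap (n : nat) (x : 'I_(2 * n)) :
  odd (block_swap n x) = ~~ odd x.
Proof. by rewrite /=; case: ifP => /=; lia. Qed.

(** The [K] of the overview. Each row has a single nonzero entry, so a product with it only permutes
    and signs the entries of the other factor. *)
Definition sympl_mx (T : pzRingType) (n : nat) : 'M[T]_(2 * n) :=
  \matrix_(x, y) ((-1) ^+ odd x *+ (y == block_swap n x)).

Lemma mul_sympl_mx (T : pzRingType) (n : nat) (M : 'M[T]_(2 * n)) x y :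
  (sympl_mx T n *m M) x y = (-1) ^+ odd x * M (block_swap n x) y.
Proof.
rewrite mxE (bigD1 (block_swap n x)) //= mxE eqxx big1 ?addr0 // => z /negbTE.
by rewrite mxE => ->; rewrite mul0r.
Qed.

(** Column [y] of [K] is supported on row [block_swap n y], whose parity is opposite to that of [y];
    hence the minus sign. *)
Lemma trmx_mul_sympl_mx (T : comPzRingType) (n : nat) (M : 'M[T]_(2 * n)) x y :
  (M^T *m sympl_mx T n) x y = - ((-1) ^+ odd y * M (block_swap n y) x).
Proof.
rewrite mxE (bigD1 (block_swap n y)) //= big1 => [|z zy].
  by rewrite !mxE block_swapK eqxx odd_block_swap addr0 mulrC signrN mulNr.
rewrite !mxE; case: eqP => [e|_]; last by rewrite mulr0.
by rewrite e block_swapK eqxx in zy.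
Qed.

Lemma typeIP (R : realType) (n : nat) (M : 'M[R[i]]_(2 * n)) :
  typeI M <-> M^T *m sympl_mx R[i] n = sympl_mx R[i] n *m M.
Proof.
have I2 (r : 'I_2) : r = 0 \/ r = 1.
  by case: r => -[|[|//]] ?; [left|right]; apply/val_inj.
have rev0 : rev_ord 0 = 1 :> 'I_2 by apply/val_inj.
have rev1 : rev_ord 1 = 0 :> 'I_2 by apply/val_inj.
have blockE j k r s : M (block_idx j r) (block_idx k s) = block M j k r s.
  by rewrite mxE.
split=> [[diagM offM]|skewM].
  apply/matrixP => x y; rewrite mul_sympl_mx trmx_mul_sympl_mx.
  have [j [r ->]] := block_idxP n x; have [k [s ->]] := block_idxP n y.
  rewrite !block_swap_idx !odd_block_idx !blockE.
  (* Each order of [j] and [k] makes both blocks explicit, leaving four scalar identities. *)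
  have [/offM|/offM|/val_inj <-] := ltngtP j k; last first.
  - have [t ->] := diagM j.
    by case: (I2 r) => ->; case: (I2 s) => ->; rewrite ?rev0 ?rev1 !mxE /=; ring.
  - move=> [a [b [c [d [-> ->]]]]].
    by case: (I2 r) => ->; case: (I2 s) => ->; rewrite ?rev0 ?rev1 !mxE /=; ring.
  - move=> [a [b [c [d [-> ->]]]]].
    by case: (I2 r) => ->; case: (I2 s) => ->; rewrite ?rev0 ?rev1 !mxE /=; ring.
have skew j k (r s : 'I_2) : (-1) ^+ odd r * block M j k (rev_ord r) s
                  = - ((-1) ^+ odd s * block M k j (rev_ord s) r).
  have /matrixP/(_ (block_idx j r) (block_idx k s)) := skewM.
  rewrite mul_sympl_mx trmx_mul_sympl_mx.
  by rewrite !block_swap_idx !odd_block_idx !blockE => <-.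
(* The four choices of [r] and [s] in [skew] together say that B_kj is the adjugate of B_jk. *)
have adj j k : [/\ block M k j 0 0 = block M j k 1 1,
    block M k j 0 1 = - block M j k 0 1,
    block M k j 1 0 = - block M j k 1 0 & block M k j 1 1 = block M j k 0 0].
  have := (skew j k 0 0, skew j k 0 1, skew j k 1 0, skew j k 1 1).
  rewrite !rev0 !rev1 /= !expr0 !expr1 !mul1r !mulN1r !opprK.
  move=> [[[e00 e01] e10] e11]; split.
  - by rewrite e01.
  - by rewrite e11.
  - by rewrite e00 opprK.
  - by apply: oppr_inj; rewrite -e10.
split=> [j|j k _].
  (* B_jj is its own adjugate: its diagonal entries agree, and its off-diagonal ones equal their
     negatives, so they vanish in characteristic 0. *)
  exists (block M j j 0 0); have [e00 e01 e10 _] := adj j j.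
  apply/matrixP => r s; rewrite [RHS]mxE.
  have eqN0 (z : R[i]) : z = - z -> z = 0
    by move/eqP; rewrite -addr_eq0 -mulr2n mulrn_eq0 => /eqP.
  by case: (I2 r) => ->; case: (I2 s) => ->; rewrite ?eqxx //=; apply: eqN0.
exists (block M j k 0 0), (block M j k 0 1), (block M j k 1 0),
  (block M j k 1 1).
have [e00 e01 e10 e11] := adj j k.
by split; apply/matrixP => r s; rewrite [RHS]mxE;
  case: (I2 r) => ->; case: (I2 s) => ->.
Qed.

Lemma typeII_typeI (R : realType) (n : nat) (M : 'M[R[i]]_(2 * n)) :
  typeII M -> typeI M.
Proof.
move=> [diagM offM]; split=> // j k /offM [a [b [c [d [-> ->]]]]].
(* The Type-I parameters are the entries of B_jk themselves; only signs in B_kj remain to be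
   distributed. *)
exists (a + c * 'i%C), (b + d * 'i%C), (- b^*%C - d^*%C * 'i%C),
  (a^*%C + c^*%C * 'i%C).
by rewrite !opprD !opprK.
Qed.

Theorem lemma2p5 (R : realType) (n : nat) (hn : (1 <= n)%N)
    (Omega : 'M[R[i]]_(2 * n)) (hinv : Omega \in unitmx)
    (hII : typeII Omega) : typeI (invmx Omega).
Proof.
move/typeII_typeI/typeIP: hII => skewO; apply/typeIP.
have hinvT : Omega^T \in unitmx by rewrite unitmx_tr.
(* With [W] for [Omega]: K W^-1 = W^-T (W^T K) W^-1 = W^-T (K W) W^-1 = W^-T K. *)
rewrite trmx_inv -[RHS](mulKmx hinvT).
by rewrite [Omega^T *m _]mulmxA skewO mulmxK.
Qed.
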